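(* The metric $\overline{\eta}$ is invariant under Möbius transformations which fix infinity: if $\Omega_1\subset\mathbb{C}$ is a hyperbolic domain, $T$ is a Möbius transformation with $T(\infty)=\infty$, and $\Omega_2=T(\Omega_1)$, then for every $w\in\Omega_1$ $$\overline{\eta}_{\Omega_2}(T(w))\,|T'(w)|=\overline{\eta}_{\Omega_1}(w).$$
   Context: A domain is a nonempty open connected subset of $\mathbb{C}$; a domain $\Omega\subset\mathbb{C}$ is hyperbolic if its complement $\Omega^c=\mathbb{C}\setminus\Omega$ contains at least two points. $\mathbb{D}=\{z\in\mathbb{C}:|z|<1\}$ and $\mathbb{D}^*=\mathbb{D}\setminus\{0\}$. Hurwitz density: for a domain $\Omega\subsetneq\mathbb{C}$ and $w\in\Omega$, let $\mathcal{H}_0^w(\mathbb{D},\Omega)$ be the collection of all holomorphic functions $f:\mathbb{D}\to\Omega$ such that $f(0)=w$, $f(s)\neq w$ for all $s\in\mathbb{D}^*$, and $f'(0)>0$. Put $r_\Omega(w)=\max\{f'(0): f\in\mathcal{H}_0^w(\mathbb{D},\Omega)\}$ (the maximum is known to exist) and $\eta_\Omega(w)=2/r_\Omega(w)$. For a hyperbolic domain $\Omega$ and $w\in\Omega$, $$\overline{\eta}_\Omega(w)=\sup\,\eta_{\mathbb{C}\setminus\{w_1,w_2\}}(w),$$ where the supremum is taken over all pairs of distinct points $w_1,w_2\in\Omega^c$. *)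

(* Defs.v *)
From mathcomp Require Import all_boot all_order all_algebra.
From mathcomp Require Import complex.
From mathcomp Require Import all_classical all_reals all_analysis.

Set Implicit Arguments.
Unset Strict Implicit.
Unset Printing Implicit Defensive.

Import Order.TTheory GRing.Theory Num.Theory.
Import numFieldNormedType.Exports.

Local Open Scope classical_set_scope.
Local Open Scope ring_scope.

(* The complex plane over R, as a normed module over itself: [derivable f z 1]
   is complex differentiability, [derive1 f z] the complex derivative.  The order
   and the norm on R[i] are those of mathcomp: [0 < z] means that z is real and
   positive, and [`|z|] is the modulus, embedded in R[i]. *)
Notation Cplane R := (complex R)^o.

Section HurwitzDensity.
Variable R : realType.
Implicit Types (Omega : set (Cplane R)) (f : Cplane R -> Cplane R).

Definition unit_disk : set (Cplane R) := [set z | `|z| < 1].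

Definition is_domain Omega : Prop :=
  [/\ open Omega, connected Omega & Omega !=set0].

Definition hyperbolic_domain Omega : Prop :=
  is_domain Omega /\
  exists w1 w2 : Cplane R, [/\ w1 != w2, (~` Omega) w1 & (~` Omega) w2].

Definition holomorphic_on Omega f : Prop :=
  forall z, Omega z -> derivable f z 1.

(* A holomorphic map D -> Omega is represented by a total function, of which
   only the values on the unit disk are constrained. *)
Definition hurwitz_maps Omega (w : Cplane R) : set (Cplane R -> Cplane R) :=
  [set f | [/\ holomorphic_on unit_disk f,
               (forall z, unit_disk z -> Omega (f z)),
               f 0 = w,
               (forall s, unit_disk s -> s != 0 -> f s != w)
             & 0 < derive1 f 0]].

(* The maximum of a set of reals (0 if there is none). *)
Definition max_of (A : set R) : R := xget 0 (A `&` ubound A).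

Definition hurwitz_radius Omega (w : Cplane R) : R :=
  max_of [set r : R | exists2 f, hurwitz_maps Omega w f
                               & derive1 f 0 = (r%:C)%C].

Definition hurwitz_density Omega (w : Cplane R) : R :=
  2 / hurwitz_radius Omega w.

(* The supremum is taken in the extended reals, so that its finiteness need not
   be presupposed. *)
Definition eta_bar Omega (w : Cplane R) : \bar R :=
  ereal_sup [set x : \bar R | exists w1 w2 : Cplane R,
    [/\ w1 != w2, (~` Omega) w1, (~` Omega) w2
      & x = (hurwitz_density (~` [set w1; w2]) w)%:E]].

End HurwitzDensity.

Section Moebius.
Variable R : realType.

(* The Riemann sphere; [None] is the point at infinity. *)
Definition sphere : Type := one_point_compactification (Cplane R).

Definition moebius (a b c d : Cplane R) (p : sphere) : sphere :=
  match p with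
  | Some z => if c * z + d == 0 then None else Some ((a * z + b) / (c * z + d))
  | None => if c == 0 then None else Some (a / c)
  end.

Definition is_moebius (T : sphere -> sphere) : Prop :=
  exists a b c d : Cplane R, a * d - b * c != 0 /\ T = moebius a b c d.

(* T read in the affine chart (with value 0 at the poles of T). *)
Definition affine_part (T : sphere -> sphere) (z : Cplane R) : Cplane R :=
  odflt 0 (T (Some z)).

End Moebius.

(* Main.v *)
Require Import Defs.
From mathcomp Require Import all_boot all_order all_algebra.
From mathcomp Require Import complex.
From mathcomp Require Import all_classical all_reals all_analysis.
Import Order.TTheory GRing.Theory Num.Theory.
Import numFieldNormedType.Exports.
Local Open Scope classical_set_scope.
Local Open Scope ring_scope.

(** A Möbius transformation fixing infinity is a similarity [L z = k z + m] with
    [k != 0], so the theorem is a change of variables in the definition of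
    [eta_bar].  Put [u = |k| / k], of modulus 1.  If [f] competes in the extremal
    problem for [(Omega, w)], then [z |-> L (f (u z))] competes in the one for
    [(L Omega, L w)]: the rotation by [u] preserves the disk and turns the
    derivative [k f'(0)] back to the positive number [|k| f'(0)]
    ([hurwitz_maps_affine]).  The inverse similarity undoes this, so the sets of
    derivatives of competitors differ exactly by the factor [|k|]
    ([hurwitz_derivatives_affine]), and hence so do their maxima
    ([hurwitz_radius_affine]).  The densities are thus divided by [|k|].
    Finally [L] carries the pairs of distinct points of the complement
    of [Omega] bijectively to those of [L Omega], and the supremum commutes with
    the positive factor [|k|] ([eta_bar_affine]). *)

Section Affine.
Context {K : numFieldType}.
Implicit Types (k m u z : K^o) (f : K^o -> K^o).

Definition affine k m z : K^o := k * z + m.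

Lemma affineK k m : k != 0 -> cancel (affine k m) (affine k^-1 (- (m / k))).
Proof.
move=> k0 z; rewrite /affine mulrDr mulKf// [k^-1 * m]mulrC.
by rewrite -addrA subrr addr0.
Qed.

Lemma affineVK k m : k != 0 -> cancel (affine k^-1 (- (m / k))) (affine k m).
Proof.
by move=> k0 z; rewrite /affine mulrDr mulVKf// mulrN mulrCA divff// mulr1 subrK.
Qed.

Lemma image_affineK k m (A : set K^o) : k != 0 ->
  affine k^-1 (- (m / k)) @` (affine k m @` A) = A.
Proof.
move=> k0; apply/seteqP; split=> [_ [_ [z Az <-] <-]|z Az].
  by rewrite affineK.
by exists (affine k m z); [exists z|exact: affineK].
Qed.

Lemma is_derive_affine k m z : is_derive z 1 (affine k m) k.
Proof.
have -> : affine k m = (k *: id : K^o -> K^o) + cst m by [].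
by apply: is_derive_eq; rewrite addr0 [LHS]mulr1.
Qed.

(** The chain rule in one variable over an arbitrary field of numbers, obtained
    from the chain rule for differentials, which are linear and hence
    determined by their value at 1. *)
Lemma is_derive_comp f (g : K^o -> K^o) z df dg :
  is_derive z 1 f df -> is_derive (f z) 1 g dg ->
  is_derive z 1 (g \o f) (dg * df).
Proof.
move=> [fz <-] [gz <-].
have fd : differentiable f z by exact/derivable1_diffP.
have gd : differentiable g (f z) by exact/derivable1_diffP.
have gfd : differentiable (g \o f) z by exact: differentiable_comp.
split; first exact/derivable1_diffP.
have dgf : 'd (g \o f) z 1 = 'd g (f z) ('D_1 f z).
  rewrite (deriveE _ fd).
  exact: (congr1 (fun h : K^o -> K^o => h 1) (diff_comp fd gd)).
by rewrite (deriveE _ gfd) dgf (deriv1E gz) derive1E [RHS]mulrC.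
Qed.

End Affine.

Section Similarity.
Context {R : realType}.
Implicit Types (Omega : set (Cplane R)) (f : Cplane R -> Cplane R).
Implicit Types (k m w : Cplane R).

Definition modulus (z : Cplane R) : R := complex.Re `|z|.

Lemma modulusE z : (modulus z)%:C%C = `|z| :> R[i].
Proof. by rewrite RRe_real// normr_real. Qed.

Lemma modulus_gt0 z : z != 0 -> 0 < modulus z.
Proof. by move=> z0; rewrite -ltcR modulusE normr_gt0. Qed.

Lemma modulusV z : modulus z^-1 = (modulus z)^-1.
Proof.
by apply/(@complexI R); rewrite modulusE fmorphV/= modulusE normfV.
Qed.

(** Composing with the similarity alone would multiply the derivative at 0 by
    [k], which need not be positive; precomposing with the rotation by
    [`|k| / k] cancels the argument of [k] and keeps its modulus. *)
Lemma hurwitz_maps_affine Omega w f k m : k != 0 ->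
  hurwitz_maps Omega w f ->
  let g := affine k m \o f \o affine (`|k| / k) 0 in
  hurwitz_maps (affine k m @` Omega) (affine k m w) g /\
  derive1 g 0 = `|k| * derive1 f 0.
Proof.
move=> k0 [fhol fOmega f0 fw f'0] g.
have nk0 : `|k| != 0 by rewrite normr_eq0.
have rot0 : affine (`|k| / k) 0 0 = 0 :> Cplane R by rewrite /affine mulr0 addr0.
have disk_rot z : unit_disk z -> unit_disk (affine (`|k| / k) 0 z).
  rewrite /unit_disk/= /affine addr0 !normrM normfV normr_id.
  by rewrite divff// mul1r.
have gder z : unit_disk z ->
    is_derive z 1 g (k * ('D_1 f (affine (`|k| / k) 0 z) * (`|k| / k))).
  move=> zD; apply: is_derive_comp (is_derive_affine k m _).
  apply: is_derive_comp (is_derive_affine _ _ _) _.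
  by split=> //; apply/fhol/disk_rot.
have g'0 : derive1 g 0 = `|k| * derive1 f 0.
  have D0 : unit_disk (0 : Cplane R) by rewrite /unit_disk/= normr0.
  rewrite !derive1E; have [_ ->] := gder _ D0; rewrite rot0.
  by rewrite mulrC -mulrA divfK// mulrC.
split; last exact: g'0.
split.
- by move=> z /gder[].
- by move=> z zD; exists (f (affine (`|k| / k) 0 z)) => //; apply/fOmega/disk_rot.
- by rewrite /g/= rot0 f0.
- move=> s sD s0; rewrite /g/= (can_eq (affineK k m k0)).
  apply: fw; first exact: disk_rot.
  by rewrite /affine addr0 !mulf_neq0// invr_eq0.
- by rewrite g'0 mulr_gt0// normr_gt0.
Qed.

Definition hurwitz_derivatives Omega w : set R :=
  [set r | exists2 f, hurwitz_maps Omega w f & derive1 f 0 = r%:C%C].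

Lemma image_hurwitz_derivatives_sub Omega w k m : k != 0 ->
  *%R (modulus k) @` hurwitz_derivatives Omega w `<=`
  hurwitz_derivatives (affine k m @` Omega) (affine k m w).
Proof.
move=> k0 _ [r [f fOmega f'0] <-].
have [gOmega g'0] := hurwitz_maps_affine Omega w f k m k0 fOmega.
by eexists; [exact: gOmega|rewrite g'0 f'0 rmorphM/= modulusE].
Qed.

(** The reverse inclusion is the direct one for the inverse similarity. *)
Lemma hurwitz_derivatives_affine Omega w k m : k != 0 ->
  hurwitz_derivatives (affine k m @` Omega) (affine k m w) =
  *%R (modulus k) @` hurwitz_derivatives Omega w.
Proof.
move=> k0; apply/seteqP; split; last exact: image_hurwitz_derivatives_sub.
move=> r rD; have kV0 : k^-1 != 0 by rewrite invr_eq0.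
have : hurwitz_derivatives Omega w (modulus k^-1 * r).
  have := image_hurwitz_derivatives_sub (affine k m @` Omega) (affine k m w)
    k^-1 (- (m / k)) kV0.
  by rewrite image_affineK// affineK//; apply; exists r.
move=> rD'; exists (modulus k^-1 * r) => //.
by rewrite modulusV mulVKf// gt_eqF// modulus_gt0.
Qed.

(** Both sides are 0 when there is no maximum. *)
Lemma max_of_pZl (A : set R) (c : R) : 0 < c ->
  max_of ( *%R c @` A) = c * max_of A.
Proof.
move=> c0; have c_neq0 : c != 0 by rewrite gt_eqF.
have maxZ x : (A `&` ubound A) x ->
    (( *%R c @` A) `&` ubound ( *%R c @` A)) (c * x).
  move=> [Ax ubx]; split; first by exists x.
  by move=> _ [y Ay <-]; rewrite ler_pM2l//; exact: ubx.
rewrite /max_of; case: (xgetP 0 (A `&` ubound A)) => [x -> Ax|noA].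
  apply: xget_unique; first exact: maxZ.
  move=> y [yA yub]; have [cxA cxub] := maxZ _ Ax.
  by apply/eqP; rewrite eq_le cxub// yub.
rewrite mulr0; apply: xgetPN => _ [[x Ax <-] ub]; apply: (noA x); split=> //.
by move=> y Ay; rewrite -(ler_pM2l c0); apply: ub; exists y.
Qed.

Lemma hurwitz_radius_affine Omega w k m : k != 0 ->
  hurwitz_radius (affine k m @` Omega) (affine k m w) =
  modulus k * hurwitz_radius Omega w.
Proof.
move=> k0; rewrite /hurwitz_radius -!/(hurwitz_derivatives _ _).
by rewrite hurwitz_derivatives_affine// max_of_pZl// modulus_gt0.
Qed.

Lemma hurwitz_density_affine Omega w k m : k != 0 ->
  modulus k * hurwitz_density (affine k m @` Omega) (affine k m w) =
  hurwitz_density Omega w.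
Proof.
move=> k0; rewrite /hurwitz_density hurwitz_radius_affine//.
by rewrite invfM mulrCA mulVKf// gt_eqF// modulus_gt0.
Qed.

Lemma image_affineC k m (A : set (Cplane R)) : k != 0 ->
  affine k m @` (~` A) = ~` (affine k m @` A).
Proof.
move=> k0; apply/seteqP; split=> [_ [z nAz <-] [y Ay /(can_inj (affineK k m k0))]|].
  by move=> yz; apply: nAz; rewrite -yz.
move=> z nz; exists (affine k^-1 (- (m / k)) z); last exact: affineVK.
by move=> Az; apply: nz; exists (affine k^-1 (- (m / k)) z) => //; exact: affineVK.
Qed.

Lemma eta_bar_affine Omega w k m : k != 0 ->
  (eta_bar (affine k m @` Omega) (affine k m w) * (modulus k)%:E)%E =
  eta_bar Omega w.
Proof.
move=> k0; rewrite muleC -ereal_sup_pZl ?modulus_gt0//.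
have density2 w1 w2 :
    ((modulus k)%:E *
      (hurwitz_density (~` [set affine k m w1; affine k m w2])
        (affine k m w))%:E)%E
    = (hurwitz_density (~` [set w1; w2]) w)%:E.
  rewrite -EFinM -(hurwitz_density_affine (~` [set w1; w2]) w k m k0).
  by rewrite image_affineC// image_setU !image_set1.
congr ereal_sup; apply/seteqP; split=> [_ [_ [y1 [y2 [y12 + + ->]]] <-]|x].
  rewrite -!image_affineC// => -[w1 w1Omega w1y] [w2 w2Omega w2y].
  exists w1, w2; split=> //; last by rewrite -w1y -w2y density2.
  by apply: contra_neq y12 => w12; rewrite -w1y -w2y w12.
move=> [w1 [w2 [w12 w1Omega w2Omega ->]]].
exists (hurwitz_density (~` [set affine k m w1; affine k m w2])
         (affine k m w))%:E; last exact: density2.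
exists (affine k m w1), (affine k m w2); split=> //.
- by rewrite (can_eq (affineK k m k0)).
- by rewrite -image_affineC//; exists w1.
- by rewrite -image_affineC//; exists w2.
Qed.

Lemma moebius_fix_infinity (T : sphere R -> sphere R) :
  is_moebius T -> T None = None ->
  exists k m, k != 0 /\ forall z, T (Some z) = Some (affine k m z).
Proof.
move=> [a [b [c [d [det ->]]]]] /=; case: eqP => [c0 _|_ //].
move: det; rewrite c0 mulr0 subr0 mulf_eq0 negb_or => /andP[a0 d0].
exists (a / d), (b / d); split; first by rewrite mulf_neq0// invr_eq0.
by move=> z; rewrite mul0r add0r (negPf d0) mulrDl mulrAC.
Qed.

End Similarity.

Theorem lemma4p4 (R : realType) (Omega1 Omega2 : set (Cplane R))
    (T : sphere R -> sphere R) :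
  hyperbolic_domain Omega1 ->
  is_moebius T ->
  T None = None ->
  Some @` Omega2 = T @` (Some @` Omega1) ->
  forall w : Cplane R, Omega1 w ->
    (eta_bar Omega2 (affine_part T w)
       * (complex.Re `|derive1 (affine_part T) w|)%:E)%E
    = eta_bar Omega1 w.
Proof.
move=> _ Tmoeb Tinf Omega12 w _.
have [k [m [k0 TE]]] := moebius_fix_infinity T Tmoeb Tinf.
have TA : affine_part T = affine k m.
  by apply/funext => z; rewrite /affine_part TE.
have -> : Omega2 = affine k m @` Omega1.
  have SomeK (A : set (Cplane R)) : Some @^-1` (Some @` A) = A.
    by apply/seteqP; split=> [z [y Ay [<-]]|z Az]; last exists z.
  rewrite -[LHS]SomeK -[RHS]SomeK Omega12 !image_comp; congr (_ @^-1` _).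
  by apply: eq_imagel => z _ /=; exact: TE.
rewrite TA derive1E; have [_ ->] := is_derive_affine k m w.
exact: eta_bar_affine.
Qed.
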